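(* Let $n\ge 1$, let $\Omega$ be an open set in $\mathbb{R}^n$, and let $F:\Omega\to\mathbb{R}^n$ be differentiable (at every point of $\Omega$). Suppose that $x_0$ is a point in $\Omega$ such that $JF(x_0)$ is invertible, with $JF(x)$ continuous at $x_0$. Then there exist an open set $X\subseteq\Omega$ containing $x_0$, an open set $Y\subseteq\mathbb{R}^n$ containing $y_0=F(x_0)$ with $F(X)\subseteq Y$, and a differentiable function $G:Y\to X$ that satisfies $F(G(y))=y$ for all $y$ in $Y$, and $G(F(x))=x$ for all $x$ in $X$. In addition, $$JG(y)=JF(G(y))^{-1},\quad\text{for all } y \text{ in } Y,$$ and $JG(y)$ is continuous at $y=y_0$.
   Context: Differentiable means (Fréchet) differentiable at every point of the domain. $JF(x)=\left(\frac{\partial F_i}{\partial x_j}(x)\right)_{1\le i,j\le n}$ denotes the Jacobian matrix of $F=(F_1,\dots,F_n)$ at $x$, regarded as a matrix-valued function on the domain; similarly for $JG$. *)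

(* Defs.v *)
From mathcomp Require Import all_boot all_order all_algebra.
From mathcomp Require Import all_classical all_reals all_analysis.

Set Implicit Arguments.
Unset Strict Implicit.
Unset Printing Implicit Defensive.

Import Order.TTheory GRing.Theory Num.Theory.
Import numFieldNormedType.Exports.

Local Open Scope classical_set_scope.
Local Open Scope ring_scope.

(* Entry (i, j) is the partial derivative of the i-th component of f with
   respect to the j-th variable. The library's ['J f x] acts on row vectors by
   right multiplication, so it is the transpose of this matrix. *)
Definition jacobian_mx (R : realType) (m n : nat) (f : 'rV[R]_n -> 'rV[R]_m)
    (x : 'rV[R]_n) : 'M[R]_(m, n) :=
  \matrix_(i < m, j < n) 'D_(delta_mx 0 j) (fun u : 'rV[R]_n => f u 0 i) x.

Lemma jacobian_mxE (R : realType) (m n : nat) (f : 'rV[R]_n -> 'rV[R]_m)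
    (x : 'rV[R]_n) : differentiable f x -> jacobian_mx f x = ('J f x)^T.
Proof.
move=> fx; apply/matrixP => i j; rewrite !mxE.
have fv : derivable f x (delta_mx 0 j) by exact: diff_derivable.
have -> : 'D_(delta_mx 0 j) (fun u : 'rV[R]_n => f u 0 i) x
    = ('D_(delta_mx 0 j) f x) 0 i.
  rewrite /derive; apply: cvg_lim => //.
  rewrite (_ : (fun h => _) = (fun M : 'rV[R]_m => M 0 i) \o
    (fun h => h^-1 *: (f (h *: delta_mx 0 j + x) - f x))); last first.
    by apply/funext => h /=; rewrite !mxE.
  apply: cvg_comp; first exact: fv.
  exact: (@coord_continuous _ 1 m 0 i).
by rewrite deriveE.
Qed.

(* Main.v *)
Require Import Defs.
From HB Require Import structures.
From mathcomp Require Import all_boot all_order all_algebra.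
From mathcomp Require Import all_classical all_reals all_analysis.
From mathcomp Require Import ring lra.

Set Implicit Arguments.
Unset Strict Implicit.
Unset Printing Implicit Defensive.

Import Order.TTheory GRing.Theory Num.Theory.
Import numFieldNormedType.Exports.

Local Open Scope classical_set_scope.
Local Open Scope ring_scope.

(** The derivative is only assumed continuous at the single point [x0], and this
    suffices for two reasons.

    Write [A] for the Jacobian at [x0] and [B] for its inverse.  Near [x0] all
    Jacobians are within [e] of [A], so the mean value theorem on segments makes
    [F] strictly differentiable there: [F u - F v] differs from [A (u - v)] by at
    most [n * e * |u - v|] ([mean_value_approx]).  Hence [B F] is the identity
    plus a map [D] with Lipschitz constant [1/2] on a ball ([precond_sub_id]).
    The inequality makes [F] injective there, with a Lipschitz inverse, and the
    contraction principle makes it onto a neighbourhood of [F x0]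
    ([perturbed_id_onto]).  This gives [X], [Y] and a Lipschitz [G].

    Differentiability of [G] at a point [y] then follows from what happens at the
    point [G y] alone, namely differentiability of [F] and invertibility of the
    Jacobian, and from the Lipschitz bound on [G] ([jacobian_mx_inverse]).
    Invertibility holds throughout the ball because a matrix close enough to [A]
    is invertible ([unitmx_near]).  Finally the Jacobian of [G] is the inverse of
    the Jacobian of [F] along [G], and matrix inversion is continuous
    ([invmx_continuous]), so it is continuous at [F x0].

    Vectors are rows, so a Jacobian [A] acts by [u |-> u *m A^T]; [|M|] is the
    largest absolute value of an entry, which is where the factors [n] come
    from. *)

(** * The entrywise norm and continuity of matrix inversion *)

Lemma mx_norm_leP (R : realType) m n (M : 'M[R]_(m, n)) (e : R) :
  0 <= e -> (`|M| <= e <-> forall i j, `|M i j| <= e).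
Proof.
move=> e0; rewrite {1}/Num.norm /= mx_normrE; split=> [/bigmax_leP [_ Me] i j|Me].
  exact: (Me (i, j)).
by apply/bigmax_leP; split=> // -[i j] _; exact: Me.
Qed.

Lemma mx_entry_le_norm (R : realType) m n (M : 'M[R]_(m, n)) i j :
  `|M i j| <= `|M|.
Proof. by have /mx_norm_leP := lexx `|M|; apply. Qed.

Lemma mx_norm_trmx (R : realType) m n (M : 'M[R]_(m, n)) : `|M^T| = `|M|.
Proof.
apply/eqP; rewrite eq_le; apply/andP; split.
  by apply/mx_norm_leP => // i j; rewrite mxE mx_entry_le_norm.
by apply/mx_norm_leP => // i j; have := mx_entry_le_norm M^T j i; rewrite mxE.
Qed.

Lemma norm_mulmx_le (R : realType) m n (u : 'rV[R]_m) (M : 'M[R]_(m, n)) :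
  `|u *m M| <= m%:R * `|M| * `|u|.
Proof.
apply/mx_norm_leP => [|i j]; first by rewrite !mulr_ge0.
rewrite mxE (le_trans (ler_norm_sum _ _ _))//.
rewrite (@le_trans _ _ (\sum_(k < m) `|M| * `|u|))//.
  apply: ler_sum => k _; rewrite normrM mulrC.
  by rewrite ler_pM// mx_entry_le_norm.
by rewrite sumr_const card_ord -[leLHS]mulr_natl mulrA.
Qed.

(** Finitely many entries, so entrywise convergence is uniform in the entry. *)
Lemma cvg_mxP (R : realType) (T : Type) (F : set_system T) {FF : Filter F} m n
    (f : T -> 'M[R]_(m, n)) (M : 'M[R]_(m, n)) :
  (forall i j, f x i j @[x --> F] --> M i j) -> f x @[x --> F] --> M.
Proof.
move=> fM; apply/cvgrPdist_le => e e0.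
have : \forall x \near F, forall i j, `|M i j - f x i j| <= e.
  apply: filter_forall => i; apply: filter_forall => j.
  by move/cvgrPdist_le: (fM i j); apply.
by apply: filterS => x Mf; apply/mx_norm_leP => [|i j]; [exact: ltW|rewrite !mxE].
Qed.

Lemma cvg_det (R : realType) (T : Type) (F : set_system T) {FF : Filter F} n
    (f : T -> 'M[R]_n) (M : 'M[R]_n) :
  (forall i j, f x i j @[x --> F] --> M i j) -> \det (f x) @[x --> F] --> \det M.
Proof.
move=> fM; rewrite /determinant.
apply: (cvg_big (@add_continuous R)) => s _.
apply: cvgM; first exact: cvg_cst.
by apply: (cvg_big (@mul_continuous R)) => i _; exact: fM.
Qed.

(** By Cramer's formula the inverse is the adjugate divided by the determinant,
    and near a unit the determinant does not vanish. *)
Lemma invmx_continuous (R : realType) n (M : 'M[R]_n) :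
  M \in unitmx -> {for M, continuous (@invmx R n)}.
Proof.
move=> uM; rewrite /prop_for /continuous_at.
have entry (i j : 'I_n) : (N : 'M[R]_n) i j @[N --> M] --> M i j.
  exact: coord_continuous.
have det_cvg : \det (N : 'M[R]_n) @[N --> M] --> \det M.
  exact: (@cvg_det R 'M[R]_n (nbhs M) _ n id M entry).
have detM0 : \det M != 0 by rewrite -unitfE -unitmxE.
have -> : invmx M = (\det M)^-1 *: \adj M by rewrite /invmx uM.
apply: (@cvg_trans _ ((\det N)^-1 *: \adj N @[N --> M])); last first.
  apply: (@cvg_mxP R 'M[R]_n (nbhs M)) => i j; rewrite !mxE.
  under eq_cvg do rewrite !mxE.
  apply: cvgM; first exact: cvgV.
  apply: cvgM; first exact: cvg_cst.
  apply: (@cvg_det R 'M[R]_n (nbhs M)) => k l; rewrite !mxE.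
  by under eq_cvg do rewrite !mxE; exact: entry.
have detN : \forall N \near M, `|\det M - \det N| < `|\det M|.
  by move/cvgrPdist_lt : det_cvg; apply; rewrite normr_gt0.
apply: (@near_eq_cvg _ _ (nbhs M)); near=> N.
have MN : `|\det M - \det N| < `|\det M| by near: N.
rewrite /invmx unitmxE unitfE ifT//.
by apply: contraTneq MN => ->; rewrite subr0 ltxx.
Unshelve. all: by end_near. Qed.

(** * Linear approximation and the mean value inequality *)

(** The join of the normed and the complete structures of matrices, through
    which the contraction principle applies to row vectors. *)
HB.instance Definition _ (R : realType) (m n : nat) :=
  Uniform_isComplete.Build 'M[R]_(m, n) cauchy_cvg.

Lemma mulmxr_continuous (R : realType) m n (M : 'M[R]_(m, n)) :
  continuous (mulmxr M : 'rV[R]_m -> 'rV[R]_n).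
Proof.
apply: bounded_linear_continuous; apply/bounded_funP => r.
exists (m%:R * `|M| * r) => u ur.
by rewrite (le_trans (norm_mulmx_le _ _))// ler_wpM2l// mulr_ge0.
Qed.

(** The epsilon form of differentiability.  It is used in both directions: to
    read an estimate off a known derivative, and to obtain the derivative of an
    inverse map from an estimate. *)
Lemma jacobian_mxP (R : realType) m n (f : 'rV[R]_n -> 'rV[R]_m)
    (x : 'rV[R]_n) (A : 'M[R]_(m, n)) :
  differentiable f x /\ jacobian_mx f x = A <->
  forall e, 0 < e ->
    \forall h \near (0 : 'rV[R]_n),
      `|f (h + x) - f x - h *m A^T| <= e * `|h|.
Proof.
have cA := @mulmxr_continuous R n m A^T.
have dfP : f \o shift x = cst (f x) + (mulmxr A^T : _ -> _) +o_ (0 : 'rV[R]_n) id <->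
  forall e, 0 < e ->
    \forall h \near (0 : 'rV[R]_n),
      `|f (h + x) - f x - h *m A^T| <= e * `|h|.
  rewrite eqaddoP; split=> fA e e0; have := fA e e0;
    by apply: filterS => h; rewrite /= !fctE /= opprD addrA.
rewrite -dfP; split=> [[df <-]|fA].
  rewrite (jacobian_mxE df) trmxK.
  have -> : mulmxr ('J f x) = 'd f x :> ('rV[R]_n -> 'rV[R]_m).
    by apply/funext => h /=; rewrite /jacobian mul_rV_lin1.
  exact: diff_locally.
have dfE : 'd f x = mulmxr A^T :> ('rV[R]_n -> 'rV[R]_m) by exact: diff_unique.
have df : differentiable f x.
  by apply/diff_locallyP; rewrite dfE; split.
split=> //; rewrite (jacobian_mxE df); apply: trmx_inj; rewrite trmxK.
by apply/row_matrixP => i; rewrite !rowE /jacobian mul_rV_lin1 dfE.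
Qed.

(** The one-variable mean value theorem is applied to each coordinate of
    [x |-> f x - x *m A^T] along the segment from [v] to [u]: the derivative is
    then [(u - v) *m (jacobian_mx f x - A)^T] at some point [x] of the segment,
    which may depend on the coordinate because the norm is a maximum. *)
Lemma mean_value_approx (R : realType) m n (f : 'rV[R]_n -> 'rV[R]_m)
    (A : 'M[R]_(m, n)) (c : 'rV[R]_n) (r e : R) :
  (forall x, ball c r x -> differentiable f x) ->
  (forall x, ball c r x -> `|jacobian_mx f x - A| <= e) ->
  forall u v, ball c r u -> ball c r v ->
  `|f u - f v - (u - v) *m A^T| <= n%:R * e * `|u - v|.
Proof.
move=> df fA u v cu cv.
have e0 : 0 <= e by rewrite (le_trans _ (fA _ cu)).
(* [p] runs along the segment, which stays in the ball by convexity. *)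
pose p (t : R) := t *: (u - v) + v.
have cp t : 0 <= t <= 1 -> ball c r (p t).
  move=> /andP[t0 t1]; move: cu cv; rewrite -!ball_normE /= => cu cv.
  have -> : c - p t = t *: (c - u) + (1 - t) *: (c - v).
    by rewrite /p scalerBl scale1r !scalerBr; apply/rowP => j; rewrite !mxE; ring.
  have [->|tn0] := eqVneq t 0; first by rewrite scale0r add0r subr0 scale1r.
  rewrite (le_lt_trans (ler_normD _ _))// !normrZ !ger0_norm ?subr_ge0//.
  have -> : r = t * r + (1 - t) * r by ring.
  by rewrite ltr_leD ?ltr_pM2l ?lt0r ?tn0// ler_wpM2l ?subr_ge0 ?(ltW cv).
apply/mx_norm_leP => [|i j]; first by rewrite !mulr_ge0.
rewrite ord1 {i}.
pose g (t : R) : R := (f (p t) - (p t) *m A^T) 0 j.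
pose dg (t : R) : R := ((u - v) *m (jacobian_mx f (p t) - A)^T) 0 j.
have gd (t : R) : 0 <= t <= 1 -> is_derive t 1 g (dg t).
  move=> t01; have dfp := df _ (cp _ t01).
  have fcvg : h^-1 *: (f (h *: (u - v) + p t) - f (p t)) @[h --> 0^'] -->
      (u - v) *m (jacobian_mx f (p t))^T.
    rewrite (jacobian_mxE dfp) trmxK -deriveEjacobian//.
    exact: diff_derivable.
  (* Up to the linear term, the difference quotient of [g] at [t] is a coordinate
     of that of [f] at [p t] in the direction [u - v]. *)
  have gcvg : h^-1 *: ((g \o shift t) (h *: 1) - g t) @[h --> 0^'] --> dg t.
    pose Q (h : R) := h^-1 *: (f (h *: (u - v) + p t) - f (p t)).
    apply: (@cvg_trans _ (Q h 0 j - ((u - v) *m A^T) 0 j @[h --> 0^'])).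
      apply: near_eq_cvg; near=> h.
      have h0 : h != 0 by near: h; exact: nbhs_dnbhs_neq.
      have pD : p (h *: 1 + t) = h *: (u - v) + p t.
        by rewrite /p [h *: 1]mulr1 scalerDl addrA.
      have pA : (h *: (u - v) + p t) *m A^T = h *: ((u - v) *m A^T) + p t *m A^T.
        by rewrite mulmxDl -scalemxAl.
      rewrite /Q /g /= pD pA.
      move: (f _) (f (p t)) (p t *m _) ((u - v) *m _) => a b w z.
      by rewrite !mxE /GRing.scale /=; field.
    have -> : dg t = ((u - v) *m (jacobian_mx f (p t))^T) 0 j -
        ((u - v) *m A^T) 0 j.
      by rewrite /dg linearB /= mulmxBr !mxE.
    apply: cvgB; last exact: cvg_cst.
    apply: (@cvg_comp _ _ _ Q (fun M : 'rV[R]_m => M 0 j) _ _ _ fcvg).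
    exact: coord_continuous.
  by split; [apply/cvg_ex; exists (dg t)|exact: cvg_lim].
have [||t] := @MVT R g dg 0 1 ltr01.
- by move=> t; rewrite in_itv /= => /andP[t0 t1]; apply: gd; rewrite !ltW.
- apply: derivable_within_continuous => t; rewrite in_itv /= => t01.
  by have dgt := gd t t01; apply: ex_derive.
rewrite in_itv /= subr0 mulr1 => /andP[t0 t1].
rewrite /g /p scale1r scale0r subrK add0r => gE.
rewrite (_ : _ 0 j = dg t); last first.
  by rewrite -gE mulmxBl !mxE; ring.
rewrite (le_trans (mx_entry_le_norm _ _ _))// (le_trans (norm_mulmx_le _ _))//.
rewrite ler_wpM2r// ler_wpM2l// mx_norm_trmx fA//.
by apply: cp; rewrite !ltW.
Unshelve. all: by end_near. Qed.

(** * Inverting a map close to a linear one *)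

(** A solution of [x + D x = y] is a fixed point of the contraction
    [x |-> y - D x].  The bound on [y] makes this contraction send the closed ball
    into the open one, which keeps the solution off the boundary: an inverse
    with values in the open ball, hence an open [X], becomes possible. *)
Lemma perturbed_id_onto (R : realType) (V : completeNormedModType R)
    (D : V -> V) (c : V) (s q : R) :
  0 <= q -> q < 1 ->
  (forall u v, `|c - u| <= s -> `|c - v| <= s ->
     `|D u - D v| <= q * `|u - v|) ->
  forall y, `|y - (c + D c)| < (1 - q) * s ->
  exists2 x, `|c - x| < s & x + D x = y.
Proof.
move=> q0 q1 Dq y yc.
have s0 : 0 <= s.
  by rewrite -(@pmulr_rge0 _ (1 - q)) ?subr_gt0// (le_trans _ (ltW yc)).
pose T x := y - D x.
have cc : `|c - c| <= s by rewrite subrr normr0.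
have Tc x : `|c - x| <= s -> `|c - T x| < s.
  move=> cx; have -> : c - T x = (D x - D c) - (y - (c + D c)).
    by rewrite !opprB addrCA [c + D c]addrC -[_ + c - y]addrA [RHS]addrA subrK.
  rewrite (le_lt_trans (ler_normB _ _))//.
  have -> : s = q * s + (1 - q) * s by ring.
  by rewrite ler_ltD// (le_trans (Dq _ _ cx cc))// ler_wpM2l// distrC.
have TB : set_fun (closed_ball_ Num.norm c s) (closed_ball_ Num.norm c s) T.
  by move=> x /= cx; exact: ltW (Tc x cx).
have [T' TT'] := Pfun TB.
have [|||x cx] := @banach_fixed_point R V (closed_ball_ Num.norm c s) T'.
- exists (NngNum q0); split=> // -[u v] [/= cu cv]; rewrite -TT' /T.
  by rewrite /= opprB addrC subrKA distrC Dq.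
- exact: closed_closed_ball_.
- by exists c.
rewrite -TT' => xT; exists x; first by rewrite xT; exact: Tc.
by rewrite {1}xT subrK.
Qed.

(** If [v *m M = 0] then [v = v *m (A - M) *m invmx A], whose norm is strictly
    smaller than that of [v] unless [v = 0]. *)
Lemma unitmx_near (R : realType) n (A M : 'M[R]_n) (e : R) :
  A \in unitmx -> `|M - A| <= e -> n%:R * `|invmx A| * (n%:R * e) < 1 ->
  M \in unitmx.
Proof.
move=> uA MA e1; rewrite -row_free_unit -kermx_eq0; apply/rowV0P => v.
rewrite sub_kermx => /eqP vM0.
have vE : v = (v *m (A - M)) *m invmx A.
  by rewrite mulmxBr vM0 subr0 mulmxK.
have : `|v| <= n%:R * `|invmx A| * (n%:R * e) * `|v|.
  rewrite {1}vE (le_trans (norm_mulmx_le _ _))// -[leRHS]mulrA ler_wpM2l ?mulr_ge0//.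
  rewrite (le_trans (norm_mulmx_le _ _))// ler_wpM2r// ler_wpM2l//.
  by rewrite distrC.
have [->//|v0] := eqVneq v 0.
by rewrite ler_pMl ?normr_gt0// leNgt e1.
Qed.

(** With [w := G (y + h) - G y] and [J] the Jacobian of [F] at [G y],
    differentiability of [F] reads [h = w *m J^T + o(w)].  Applying the inverse of
    [J] gives [w = h *m (invmx J)^T + o(w)], and the Lipschitz bound turns [o(w)]
    into [o(h)]. *)
Lemma jacobian_mx_inverse (R : realType) n (F G : 'rV[R]_n -> 'rV[R]_n)
    (y : 'rV[R]_n) (c : R) :
  differentiable F (G y) -> jacobian_mx F (G y) \in unitmx ->
  (\forall z \near y, F (G z) = z) ->
  (\forall z \near y, `|G z - G y| <= c * `|z - y|) ->
  differentiable G y /\ jacobian_mx G y = invmx (jacobian_mx F (G y)).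
Proof.
move=> dF uJ FG Gc; set J := jacobian_mx F (G y).
apply/jacobian_mxP => e e0.
have /jacobian_mxP dFJ : differentiable F (G y) /\ jacobian_mx F (G y) = J by [].
pose k := n%:R * `|invmx J|.
have k0 : 0 <= k by rewrite mulr_ge0.
(* [k + 1] and [|c| + 1] stand for [k] and [c] as positive bounds, by which one
   can divide when choosing the precision [d] asked of [F]. *)
have c0 : 0 < `|c| + 1 by rewrite ltr_wpDl.
have k1 : 0 < k + 1 by rewrite ltr_wpDl.
have d0 : 0 < e / ((k + 1) * (`|c| + 1)) by rewrite divr_gt0// mulr_gt0.
set d := e / _ in d0.
have F0 : Filter (nbhs (0 : 'rV[R]_n)) by exact: nbhs_filter.
have sh : h + y @[h --> (0 : 'rV[R]_n)] --> y.
  by rewrite -[X in _ --> X]add0r; apply: cvgD; [exact: cvg_id|exact: cvg_cst].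
have FGy0 : F (G y) = y by exact: (nbhs_singleton FG).
have FG0 : \forall h \near (0 : 'rV[R]_n), F (G (h + y)) = h + y := sh _ FG.
have Gc0 : \forall h \near (0 : 'rV[R]_n),
    `|G (h + y) - G y| <= (`|c| + 1) * `|h|.
  move: (sh _ Gc); apply: (@filterS _ _ F0) => h /= /le_trans; apply.
  by rewrite addrK ler_wpM2r// (le_trans (ler_norm c))// lerDl.
have Gy : G (h + y) - G y @[h --> (0 : 'rV[R]_n)] --> (0 : 'rV[R]_n).
  apply/cvgr0Pnorm_lt => d1 d10.
  have hd : \forall h \near (0 : 'rV[R]_n), `|h| < d1 / (`|c| + 1).
    by apply: nbhs0_lt; rewrite divr_gt0.
  move: Gc0 hd; apply: (@filterS2 _ _ F0) => h /le_lt_trans wc hd; apply: wc.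
  by rewrite mulrC -ltr_pdivlMr.
have wd0 : \forall h \near (0 : 'rV[R]_n), _ := Gy _ (dFJ _ d0).
move: Gc0 FG0 wd0; apply: (@filterS3 _ _ F0) => h /=.
set w := G (h + y) - G y => wc FGh wd.
move: wd; rewrite /w subrK FGh FGy0 addrK -/w => wd.
have -> : w - h *m (invmx J)^T = - ((h - w *m J^T) *m (invmx J)^T).
  by rewrite mulmxBl -mulmxA -trmx_mul mulVmx// trmx1 mulmx1 opprB.
rewrite normrN (le_trans (norm_mulmx_le _ _))// mx_norm_trmx -/k.
rewrite (@le_trans _ _ (k * (d * ((`|c| + 1) * `|h|))))//.
  by rewrite ler_wpM2l// (le_trans wd)// ler_wpM2l// ltW.
have -> : e * `|h| = (k + 1) * (d * ((`|c| + 1) * `|h|)).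
  by rewrite /d; field; rewrite !gt_eqF.
rewrite ler_wpM2r ?lerDl// mulr_ge0 ?(ltW d0)//.
Qed.

(** Composing with the inverse of [A] turns closeness to [A] into closeness to
    the identity, the form in which the contraction principle applies. *)
Lemma precond_sub_id (R : realType) n (f : 'rV[R]_n -> 'rV[R]_n)
    (A : 'M[R]_n) (u v : 'rV[R]_n) (k : R) :
  A \in unitmx -> `|f u - f v - (u - v) *m A^T| <= k * `|u - v| ->
  `|(f u *m (invmx A)^T - u) - (f v *m (invmx A)^T - v)|
    <= n%:R * `|invmx A| * k * `|u - v|.
Proof.
move=> uA fk.
have -> : (f u *m (invmx A)^T - u) - (f v *m (invmx A)^T - v) =
    (f u - f v - (u - v) *m A^T) *m (invmx A)^T.
  rewrite [RHS]mulmxBl -mulmxA -trmx_mul mulVmx// trmx1 mulmx1 mulmxBl.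
  move: (f u *m _) (f v *m _) => a b.
  by apply/rowP => j; rewrite !mxE; ring.
rewrite (le_trans (norm_mulmx_le _ _))// mx_norm_trmx -[leRHS]mulrA.
by rewrite ler_wpM2l// mulr_ge0.
Qed.

Theorem theorem3 (R : realType) (n : nat) (hn : (1 <= n)%N)
    (Omega : set 'rV[R]_n) (hOmega : open Omega)
    (F : 'rV[R]_n -> 'rV[R]_n)
    (hF : forall x, Omega x -> differentiable F x)
    (x0 : 'rV[R]_n) (hx0 : Omega x0)
    (hinv : jacobian_mx F x0 \in unitmx)
    (hcont : {for x0, continuous (jacobian_mx F)}) :
  exists X Y : set 'rV[R]_n,
    [/\ open X, X `<=` Omega & X x0] /\
    [/\ open Y, Y (F x0) & F @` X `<=` Y] /\
    exists G : 'rV[R]_n -> 'rV[R]_n,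
      [/\ G @` Y `<=` X,
          forall y, Y y -> differentiable G y,
          forall y, Y y -> F (G y) = y &
          forall x, X x -> G (F x) = x] /\
      (forall y, Y y ->
         jacobian_mx F (G y) \in unitmx /\
         jacobian_mx G y = invmx (jacobian_mx F (G y))) /\
      {for F x0, continuous (jacobian_mx G)}.
Proof.
set A := jacobian_mx F x0 in hinv *.
pose B : 'M[R]_n := (invmx A)^T.
pose c : R := n%:R * `|invmx A|.
have c0 : 0 <= c by rewrite mulr_ge0.
(* Small enough for the displacement [D] below to be 1/2-Lipschitz; the
   additions of 1 only keep the denominator positive. *)
pose e : R := (2 * ((c + 1) * (n%:R + 1)))^-1.
have e0 : 0 < e by rewrite invr_gt0 !mulr_gt0// ltr_wpDl.
have ce : c * (n%:R * e) <= 2^-1.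
  rewrite /e invfM mulrA mulrCA -[leRHS]mulr1 ler_wpM2l// ler_pdivrMr.
    by rewrite mul1r ler_pM ?lerDl.
  by rewrite mulr_gt0// ltr_wpDl.
have [r r0 xr] : exists2 r : R, 0 < r &
    forall x, ball x0 r x -> Omega x /\ `|jacobian_mx F x - A| <= e.
  suff /nbhs_ballP [r r0 xr] : \forall x \near x0,
    Omega x /\ `|jacobian_mx F x - A| <= e by exists r.
  near=> x; split; near: x; first exact: open_nbhs_nbhs.
  by move/cvgrPdist_le: hcont => /(_ _ e0); apply: filterS => x; rewrite distrC.
have dF x : ball x0 r x -> differentiable F x by move=> /xr[/hF].
have uJ x : ball x0 r x -> jacobian_mx F x \in unitmx.
  move=> /xr[_ Je]; apply: unitmx_near hinv Je _.
  by rewrite (le_lt_trans ce)// invf_lt1// ltr1n.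
pose D x := F x *m B - x.
have DL u v : ball x0 r u -> ball x0 r v -> `|D u - D v| <= 2^-1 * `|u - v|.
  move=> xu xv; apply: le_trans (precond_sub_id hinv _) _.
    exact: (mean_value_approx dF (fun x bx => (xr x bx).2) xu xv).
  by rewrite ler_wpM2r.
(* Since [D] is 1/2-Lipschitz, [u - v] has at most twice the norm of
   [(F u - F v) *m B]; this gives both the injectivity of [F] and the Lipschitz
   bound on its inverse. *)
have FL u v : ball x0 r u -> ball x0 r v ->
    `|u - v| <= 2 * c * `|F u - F v|.
  move=> xu xv; rewrite -mulrA -ler_pdivrMl//.
  have := norm_mulmx_le (F u - F v) B; rewrite mx_norm_trmx -/c.
  apply: le_trans.
  have uvE : u - v = (F u - F v) *m B - (D u - D v).
    by rewrite mulmxBl; apply/rowP => j; rewrite !mxE; ring.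
  have := ler_normB ((F u - F v) *m B) (D u - D v); rewrite -uvE.
  have := DL _ _ xu xv; lra.
(* The estimates hold on the open ball of radius [r]; a smaller radius is taken so
   that they hold on the closed ball of radius [s]. *)
pose s := r / 2.
have s0 : 0 < s by rewrite divr_gt0.
have sr x : `|x0 - x| <= s -> ball x0 r x.
  by rewrite -ball_normE /= => /le_lt_trans; apply; rewrite /s; lra.
have DE x : x + D x = F x *m B by rewrite /D addrC subrK.
pose Y := mulmxr B @^-1` ball (F x0 *m B) (2^-1 * s).
have YE y : Y y = (`|F x0 *m B - y *m B| < 2^-1 * s) by rewrite /Y -ball_normE.
have onto y : Y y -> exists x, `|x0 - x| < s /\ F x = y.
  move=> Yy; have [||||x xs xy] := @perturbed_id_onto R _ D x0 s 2^-1 _ _ _ (y *m B).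
  - by rewrite invr_ge0.
  - by rewrite invf_lt1// ltr1n.
  - by move=> u v /sr xu /sr xv; exact: DL.
  - by move: Yy; rewrite YE DE distrC (_ : 1 - 2^-1 = 2^-1)//; lra.
  exists x; split=> //; move: xy; rewrite DE.
  move/(congr1 (mulmx^~ A^T)).
  by rewrite -!mulmxA -trmx_mul mulmxV// trmx1 !mulmx1.
pose G y := xget x0 [set x | `|x0 - x| < s /\ F x = y].
have Gs y : Y y -> `|x0 - G y| < s /\ F (G y) = y.
  by move=> /onto ex; exact: (xgetPex x0 ex).
have Gr y : Y y -> ball x0 r (G y) by move=> /Gs[/ltW/sr].
have openY : open Y.
  apply: open_comp; last exact: ball_open.
  by move=> y _; exact: mulmxr_continuous.
have nY y : Y y -> \forall z \near y, Y z by move=> Yy; exact: open_nbhs_nbhs.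
have YF0 : Y (F x0) by rewrite YE subrr normr0 mulr_gt0.
have GL y : Y y -> \forall z \near y, `|G z - G y| <= 2 * c * `|z - y|.
  move=> Yy; apply: filterS (nY _ Yy) => z Yz.
  by have := FL _ _ (Gr _ Yz) (Gr _ Yy); rewrite (Gs _ Yz).2 (Gs _ Yy).2.
have dG y : Y y ->
    differentiable G y /\ jacobian_mx G y = invmx (jacobian_mx F (G y)).
  move=> Yy; apply: (@jacobian_mx_inverse _ _ _ _ _ (2 * c)) => //.
  - exact/dF/Gr.
  - exact/uJ/Gr.
  - by apply: filterS (nY _ Yy) => z /Gs[].
  - exact: GL.
have GF x : `|x0 - x| < s -> Y (F x) -> G (F x) = x.
  move=> xs YFx; have xr' := sr _ (ltW xs).
  apply/eqP; rewrite -subr_eq0 -normr_le0.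
  by have := FL _ _ (Gr _ YFx) xr'; rewrite (Gs _ YFx).2 subrr normr0 mulr0.
exists [set x | `|x0 - x| < s /\ Y (F x)], Y; split; last split.
- split; [|by move=> x [/ltW/sr/xr[]]|by split=> //=; rewrite subrr normr0].
  rewrite openE => x /= [xs YFx]; apply: filterI.
    have : open_nbhs x (ball x0 s).
      by split; [exact: ball_open|rewrite -ball_normE].
    by move/open_nbhs_nbhs; rewrite -ball_normE.
  have /differentiable_continuous Fx := dF _ (sr _ (ltW xs)).
  exact: Fx (nY _ YFx).
- by split=> // _ [x [_ YFx] <-].
exists G; split; last split.
- split.
  + by move=> _ [y Yy <-]; have [Gys FGy] := Gs _ Yy; split=> //; rewrite FGy.
  + by move=> y /dG[].
  + by move=> y /Gs[].
  + by move=> x [xs YFx]; exact: GF.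
- by move=> y Yy; split; [exact/uJ/Gr|exact: (dG _ Yy).2].
rewrite /prop_for /continuous_at (dG _ YF0).2.
apply: (@cvg_trans _ (invmx (jacobian_mx F (G y)) @[y --> F x0])).
  apply: (@near_eq_cvg _ _ (nbhs (F x0))); apply: filterS (nY _ YF0) => y Yy.
  by rewrite (dG _ Yy).2.
have GFx0 : G (F x0) = x0 by apply: GF => //; rewrite subrr normr0.
have Gcvg : G y @[y --> F x0] --> x0.
  rewrite -[X in _ --> X]GFx0.
  by apply: differentiable_continuous; exact: (dG _ YF0).1.
rewrite GFx0.
have JGcvg := cvg_comp G (jacobian_mx F) Gcvg hcont.
exact: cvg_comp JGcvg (invmx_continuous hinv).
Unshelve. all: by end_near. Qed.
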